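(* Let $\Phi$, $g$, $f=\Phi-g$, $L_{yx}$, $L_{yy}$ satisfy the standing assumptions in the context with $\nu=0$, and let $(x^*,y^* )$ be a saddle-point of $f$. Let $c_\alpha>L_{yx}\ge 0$ and let $\tau,\sigma>0$ be such that $$(c_\alpha L_{yx}\tau+2L_{yy})\sigma<1.$$ Let $((x^k,y^k))_{k\in\mathbb{N}}$ be generated by OGAProx (see context) with $\tau_k\equiv\tau$, $\sigma_k\equiv\sigma$, $\theta_k\equiv1$ for all $k\in\mathbb{N}$, and let $\hat{x}_k,\hat{y}_k$ be the ergodic averages defined in the context (so that $t_k\equiv 1$). Then for every $k\in\mathbb{N}\smallsetminus\{0\}$, $$-\frac1k\left(\frac{1}{2\tau}\|\hat{x}_k-x^0\|^2+\frac{1}{2\sigma}\|y^*-y^0\|^2\right)\le f(\hat{x}_k,\hat{y}_k)-f(x^*,y^* )\le\frac1k\left(\frac{1}{2\tau}\|x^*-x^0\|^2+\frac{1}{2\sigma}\|\hat{y}_k-y^0\|^2\right).$$ Consequently, $(f(\hat{x}_k,\hat{y}_k))_{k\ge1}$ converges to $f(x^*,y^* )$ with rate $\mathcal{O}\left(\frac1k\right)$, i.e. $|f(\hat{x}_k,\hat{y}_k)-f(x^*,y^* )|=\mathcal{O}\left(\frac1k\right)$.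
   Context: $\mathbb{N}=\{0,1,2,\dots\}$. $\mathcal{H}_1,\mathcal{H}_2$ are real Hilbert spaces; $\Phi:\mathcal{H}_1\times\mathcal{H}_2\to\mathbb{R}\cup\{+\infty\}$ with $\operatorname{dom}\Phi=\{(x,y):\Phi(x,y)<+\infty\}\ne\varnothing$; $g:\mathcal{H}_2\to\mathbb{R}\cup\{+\infty\}$; $f(x,y)=\Phi(x,y)-g(y)$. Set $P=\{u\in\mathcal{H}_1:\exists y\in\mathcal{H}_2,\ (u,y)\in\operatorname{dom}\Phi\}$. Standing assumptions: - $g$ is proper, lower semicontinuous, and convex with modulus $\nu\ge0$, i.e. $g-\frac{\nu}{2}\|\cdot\|^2$ is convex. - For every $y\in\operatorname{dom}g$, $\Phi(\cdot,y):\mathcal{H}_1\to\mathbb{R}\cup\{+\infty\}$ is proper, convex and lower semicontinuous. - $P$ is closed, and for every $x\in P$, $\operatorname{dom}\Phi(x,\cdot)=\mathcal{H}_2$ and $\Phi(x,\cdot):\mathcal{H}_2\to\mathbb{R}$ is concave and Fréchet differentiable. - There are $L_{yx},L_{yy}\ge0$ such that for all $(x,y),(x',y')\in P\times\operatorname{dom}g$: $\|\nabla_y\Phi(x,y)-\nabla_y\Phi(x',y')\|\le L_{yx}\|x-x'\|+L_{yy}\|y-y'\|$. - $f$ has a saddle-point, i.e. a point $(x^*,y^* )\in\mathcal{H}_1\times\mathcal{H}_2$ with $f(x^*,y)\le f(x^*,y^* )\le f(x,y^* )$ for all $(x,y)\in\mathcal{H}_1\times\mathcal{H}_2$. Proximity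 operator: $\operatorname{Prox}_h(x)=\operatorname{argmin}_{y}\left(h(y)+\frac12\|x-y\|^2\right)$ for $h$ proper, convex, lower semicontinuous. OGAProx: given $(x^0,y^0)\in P\times\operatorname{dom}g$, $(x^{-1},y^{-1}):=(x^0,y^0)$, and parameters $\sigma_k,\tau_k>0$, $\theta_k\in(0,1]$, for every $k\in\mathbb{N}$: $$y^{k+1}=\operatorname{Prox}_{\sigma_kg}\big(y^k+\sigma_k[(1+\theta_k)\nabla_y\Phi(x^k,y^k)-\theta_k\nabla_y\Phi(x^{k-1},y^{k-1})]\big),\qquad x^{k+1}=\operatorname{Prox}_{\tau_kf(\cdot,y^{k+1})}(x^k).$$ Ergodic averages: $t_k=\frac{\theta_0}{\theta_0\theta_1\cdots\theta_k}$ for $k\in\mathbb{N}$, and for $k\ge1$, $\hat{x}_k=\frac{1}{\sum_{i=0}^{k-1}t_i}\sum_{j=0}^{k-1}t_jx^{j+1}$, $\hat{y}_k=\frac{1}{\sum_{i=0}^{k-1}t_i}\sum_{j=0}^{k-1}t_jy^{j+1}$. *)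

(* Defs.v *)
From HB Require Import structures.
From mathcomp Require Import all_boot all_order all_algebra.
From mathcomp Require Import all_classical all_reals all_analysis.

Set Implicit Arguments.
Unset Strict Implicit.
Unset Printing Implicit Defensive.

Import Order.TTheory GRing.Theory Num.Theory.
Import numFieldNormedType.Exports.

Local Open Scope classical_set_scope.
Local Open Scope ring_scope.

(** A real Hilbert space is represented by a complete normed space [H] together
    with an inner product [ip : {dot H for idfun}] that induces its norm. *)
Definition induces_norm (R : realType) (H : completeNormedModType R)
    (ip : {dot H for idfun}) : Prop :=
  forall u : H, ip u u = `|u| ^+ 2.

Section ExtendedRealFunctions.
Context {R : realType} {V : completeNormedModType R}.
Implicit Types h : V -> \bar R.
Local Open Scope ereal_scope.

Definition edom h : set V := [set u | h u < +oo].

Definition proper h : Prop := (forall u, -oo < h u) /\ edom h !=set0.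

(** Meant for functions that never take the value [-oo]: the right-hand side is
    then never of the form [+oo - oo]. *)
Definition econvex h : Prop := forall (u v : V) (t : R), (0 < t < 1)%R ->
  h (t *: u + (1 - t) *: v)%R <= t%:E * h u + (1 - t)%:E * h v.

Definition econvex_modulus (nu : R) h : Prop :=
  econvex (fun u => h u - (nu / 2 * `|u| ^+ 2)%:E).

Definition argmin h : set V := [set p | forall q, h p <= h q].

(** Set-valued: for [h] proper, convex and lower semicontinuous, [prox h u] is a
    singleton, and [p = Prox_h(u)] is rendered as [prox h u p]. *)
Definition prox h (u : V) : set V :=
  argmin (fun v => h v + (2^-1 * `|u - v| ^+ 2)%:E).

End ExtendedRealFunctions.

(** The Riesz representative of the Frechet differential. *)
Definition gradient (R : realType) (H : completeNormedModType R)
    (ip : {dot H for idfun}) (F : H -> R) (y : H) : H :=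
  get [set v : H | forall h : H, 'd F y h = ip v h].

Section Minimax.
Context {R : realType} {H1 H2 : completeNormedModType R}.
Variable ip2 : {dot H2 for idfun}.
Variables (Phi : H1 -> H2 -> \bar R) (g : H2 -> \bar R).
Local Open Scope ereal_scope.

(** The subtraction is the one of [ereal_dual_scope], for which
    [+oo - +oo = +oo]; with it, [objective x y = +oo] whenever
    [Phi x y = +oo]. *)
Definition objective (x : H1) (y : H2) : \bar R := (Phi x y - g y)%dE.

Definition proj_dom : set H1 := [set u | exists y, Phi u y < +oo].

Definition grad_y (x : H1) (y : H2) : H2 :=
  gradient ip2 (fun y' => fine (Phi x y')) y.

Definition saddle_point (xs : H1) (ys : H2) : Prop :=
  forall x y, objective xs y <= objective xs ys <= objective x ys.

Record standing_assumptions (nu Lyx Lyy : R) : Prop := {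
  Phi_gtNy : forall x y, -oo < Phi x y;
  dom_Phi_neq0 : exists x y, Phi x y < +oo;
  modulus_ge0 : (0 <= nu)%R;
  g_proper : proper g;
  g_lsc : lower_semicontinuous g;
  g_convex : econvex_modulus nu g;
  Phi_proper : forall y, edom g y -> proper (Phi ^~ y);
  Phi_convex : forall y, edom g y -> econvex (Phi ^~ y);
  Phi_lsc : forall y, edom g y -> lower_semicontinuous (Phi ^~ y);
  proj_dom_closed : closed proj_dom;
  Phi_dom : forall x, proj_dom x -> edom (Phi x) = setT;
  Phi_concave : forall x, proj_dom x -> econvex (fun y => - Phi x y);
  Phi_differentiable : forall x, proj_dom x ->
    forall y, differentiable (fun y' => fine (Phi x y')) y;
  Lyx_ge0 : (0 <= Lyx)%R;
  Lyy_ge0 : (0 <= Lyy)%R;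
  grad_y_lipschitz : forall x x' y y',
    proj_dom x -> proj_dom x' -> edom g y -> edom g y' ->
    (`|grad_y x y - grad_y x' y'| <= Lyx * `|x - x'| + Lyy * `|y - y'|)%R;
  saddle_point_exists : exists xs ys, saddle_point xs ys
}.

(** As [0.-1 = 0], the index [k.-1] encodes [(x^{-1}, y^{-1}) := (x^0, y^0)]. *)
Record OGAProx (sigma tau theta : nat -> R) (x : nat -> H1) (y : nat -> H2)
    : Prop := {
  sigma_gt0 : forall k, (0 < sigma k)%R;
  tau_gt0 : forall k, (0 < tau k)%R;
  theta_itv : forall k, (0 < theta k <= 1)%R;
  x0_dom : proj_dom (x 0%N);
  y0_dom : edom g (y 0%N);
  y_step : forall k,
    prox (fun v => (sigma k)%:E * g v)
         (y k + sigma k *: ((1 + theta k) *: grad_y (x k) (y k)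
                            - theta k *: grad_y (x k.-1) (y k.-1)))%R
         (y k.+1);
  x_step : forall k,
    prox (fun u => (tau k)%:E * objective u (y k.+1)) (x k) (x k.+1)
}.

End Minimax.

Definition ergodic_weight (R : realType) (theta : nat -> R) (k : nat) : R :=
  theta 0%N / \prod_(i < k.+1) theta i.

Definition ergodic_average (R : realType) (V : completeNormedModType R)
    (theta : nat -> R) (z : nat -> V) (k : nat) : V :=
  (\sum_(i < k) ergodic_weight theta i)^-1
    *: \sum_(j < k) ergodic_weight theta j *: z j.+1.

(* Main.v *)
(** Fix (u, v) and put q_k = grad_y Phi(x^k, y^k) - grad_y Phi(x^{k-1}, y^{k-1}),
    so that the y-step moves along grad_y Phi(x^k, y^k) + q_k.  The three-point
    inequalities of the two proximal steps and the concavity of Phi(x^{k+1}, .)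
    bound f(x^{k+1}, v) - f(u, y^{k+1}) by differences of squared distances plus
    <q_{k+1}, v - y^{k+1}> - <q_k, v - y^k> + <q_k, y^{k+1} - y^k>.  The first
    two products telescope; the last one is absorbed, by Lipschitz continuity,
    Young's inequality and the step-size condition, into the negative terms
    - |x^{k+1} - x^k|^2 and - |y^{k+1} - y^k|^2.  Summing and applying Jensen's
    inequality gives the two bounds, for (u, v) = (xhat, y^* ) and
    (u, v) = (x^*, yhat).  For (u, v) = (x^*, y^* ) the sum is nonnegative, so
    the leftover distance terms bound the iterates, whence the O(1/k) rate.

    On P x dom g all functions are finite, and the argument is carried out there
    with real-valued functions. *)

Require Import Defs.
From HB Require Import structures.
From mathcomp Require Import all_boot all_order all_algebra.
From mathcomp Require Import all_classical all_reals all_analysis.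
From mathcomp Require Import ring lra.

Set Implicit Arguments.
Unset Strict Implicit.
Unset Printing Implicit Defensive.

Import Order.TTheory GRing.Theory Num.Theory.
Import numFieldNormedType.Exports.

Local Open Scope classical_set_scope.
Local Open Scope ring_scope.

(** * Inner-product identities and the Cauchy-Schwarz inequality *)

Section InnerProduct.
Context {R : realType} {H : completeNormedModType R}.
Variable ip : {dot H for idfun}.
Hypothesis hilbert : induces_norm ip.
Implicit Types (u v w : H) (a t : R).

Lemma ipC u v : ip u v = ip v u.
Proof. by rewrite hermC expr0 mul1r. Qed.

Lemma ipZr a u v : ip u (a *: v) = a * ip u v.
Proof. by rewrite linearZr_LR. Qed.

Lemma sqr_normD u v : `|u + v| ^+ 2 = `|u| ^+ 2 + 2 * ip u v + `|v| ^+ 2.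
Proof. rewrite -!hilbert linearDl !linearDr /= (ipC v u); ring. Qed.

Lemma sqr_normB u v : `|u - v| ^+ 2 = `|u| ^+ 2 - 2 * ip u v + `|v| ^+ 2.
Proof. by rewrite sqr_normD normrN linearNr mulrN. Qed.

Lemma sqr_normZ a u : `|a *: u| ^+ 2 = a ^+ 2 * `|u| ^+ 2.
Proof. by rewrite normrZ exprMn -normrX ger0_norm ?sqr_ge0. Qed.

(** The negative last term is the strong convexity of the squared norm; it produces the third
    squared distance in the three-point inequality. *)
Lemma sqr_norm_conv t u v :
  `|t *: u + (1 - t) *: v| ^+ 2
    = t * `|u| ^+ 2 + (1 - t) * `|v| ^+ 2 - t * (1 - t) * `|u - v| ^+ 2.
Proof.
rewrite (sqr_normB u v) sqr_normD !sqr_normZ ipZr (ipC (t *: u)) ipZr (ipC v); ring.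
Qed.

Lemma ip_le_norm u v : ip u v <= `|u| * `|v|.
Proof.
have [->|u0] := eqVneq u 0; first by rewrite linear0l normr0 mul0r.
have [->|v0] := eqVneq v 0; first by rewrite linear0r normr0 mulr0.
have pu : 0 < `|u| by rewrite normr_gt0.
have pv : 0 < `|v| by rewrite normr_gt0.
(* Both vectors have the same length, so the square factors as
   [2 * |u| * |v| * (|u| * |v| - ip u v)]. *)
have := sqr_ge0 `| `|v| *: u - `|u| *: v |.
rewrite sqr_normB !sqr_normZ ipZr (ipC (`|v| *: u)) ipZr (ipC v) => h.
have {}h : 0 <= (2 * (`|u| * `|v|)) * (`|u| * `|v| - ip u v).
  by apply: (le_trans h); rewrite le_eqVlt; apply/orP; left; apply/eqP; ring.
by rewrite pmulr_rge0 ?subr_ge0 // in h; rewrite !mulr_gt0.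
Qed.

End InnerProduct.

(** Convexity of an extended-real function with effective domain [D] and finite values [h]:
    stability of [D] travels with the inequality. *)
Definition convex_on (R : realType) (V : lmodType R) (D : set V) (h : V -> R) :=
  forall (u v : V) (t : R), D u -> D v -> 0 < t < 1 ->
    D (t *: u + (1 - t) *: v) /\
    h (t *: u + (1 - t) *: v) <= t * h u + (1 - t) * h v.

(** * Ergodic averages, Jensen's inequality, the three-point inequality *)

Section Convexity.
Context {R : realType}.

Lemma ergodic_average1 (V : completeNormedModType R)
    (z : nat -> V) k :
  ergodic_average (fun=> 1) z k = k%:R^-1 *: \sum_(j < k) z j.+1.
Proof.
have w1 i : ergodic_weight (fun=> 1 : R) i = 1.
  by rewrite /ergodic_weight big1 ?divr1.
rewrite /ergodic_average; under eq_bigr do rewrite w1.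
rewrite sumr_const card_ord; congr (_ *: _).
by apply: eq_bigr => j _; rewrite w1 scale1r.
Qed.

Lemma jensen_ergodic (V : completeNormedModType R) (D : set V) (h : V -> R)
    (z : nat -> V) k :
  convex_on D h -> (forall j, D (z j)) -> (0 < k)%N ->
  D (ergodic_average (fun=> 1) z k) /\
  k%:R * h (ergodic_average (fun=> 1) z k) <= \sum_(j < k) h (z j.+1).
Proof.
rewrite ergodic_average1 => ch Dz; case: k => // k _; elim: k => [|k [Dk IHk]].
  by rewrite !big_ord_recr !big_ord0 /= !add0r invr1 scale1r mul1r.
set m := k.+1 in IHk Dk *.
have m0 : 0 < m%:R :> R by rewrite ltr0n.
have t01 : 0 < (m.+1%:R^-1 : R) < 1.
  by apply/andP; split; rewrite ?invr_gt0 ?invf_lt1 ?ltr0n ?ltr1n.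
have e1 : 1 - m.+1%:R^-1 = m.+1%:R^-1 * m%:R :> R.
  have : m.+1%:R != 0 :> R by rewrite pnatr_eq0.
  by rewrite -natr1 => ?; field.
(* The new average is a two-point convex combination of the new point and the old average. *)
have -> : m.+1%:R^-1 *: \sum_(j < m.+1) z j.+1
    = m.+1%:R^-1 *: z m.+1 + (1 - m.+1%:R^-1) *: (m%:R^-1 *: \sum_(j < m) z j.+1).
  by rewrite [in LHS]big_ord_recr /= scalerDr addrC scalerA e1 mulfK // gt_eqF.
have [D' hle] := ch _ _ _ (Dz m.+1) Dk t01; split => //.
rewrite [leRHS]big_ord_recr /= -lerBlDr; apply: le_trans IHk; rewrite lerBlDr.
have p : 0 < m.+1%:R :> R by rewrite ltr0n.
apply: le_trans (ler_wpM2l (ltW p) hle) _.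
by rewrite e1 mulrDr !mulrA divff ?gt_eqF // !mul1r addrC.
Qed.

Lemma convex_on_sqr_norm (H : completeNormedModType R) (ip : {dot H for idfun})
    (c : H) : induces_norm ip -> convex_on setT (fun u => `|u - c| ^+ 2).
Proof.
move=> hilbert u v t _ _ /andP[t0 t1]; split => //.
have -> : t *: u + (1 - t) *: v - c = t *: (u - c) + (1 - t) *: (v - c).
  by rewrite !scalerBr addrACA -opprD -scalerDl addrCA subrr addr0 scale1r.
rewrite (sqr_norm_conv hilbert) lerBlDr lerDl.
by rewrite !mulr_ge0 ?exprn_ge0 // ltW // subr_gt0.
Qed.

Lemma sqr_ergodic_bounded (H : completeNormedModType R) (ip : {dot H for idfun})
    (z : nat -> H) (c d : H) B k : induces_norm ip ->
  (forall j, `|z j - c| ^+ 2 <= B) -> (0 < k)%N ->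
  `|ergodic_average (fun=> 1) z k - d| ^+ 2 <= 2 * B + 2 * `|c - d| ^+ 2.
Proof.
move=> hilbert zB k0.
have [_] := @jensen_ergodic _ _ _ z k
  (convex_on_sqr_norm d hilbert) (fun=> I) k0.
set M := 2 * B + _; set N := `|_ - d| ^+ 2 => h.
have kp : 0 < k%:R :> R by rewrite ltr0n.
rewrite -(ler_pM2l kp); apply: le_trans h _.
rewrite [k%:R * M]mulr_natl -[k in M *+ k]card_ord -sumr_const.
apply: ler_sum => j _.
have -> : z j.+1 - d = (z j.+1 - c) + (c - d) by rewrite addrA subrK.
(* This square gives [|a + b|^2 <= 2 |a|^2 + 2 |b|^2]. *)
have := sqr_ge0 `|(z j.+1 - c) - (c - d)|; have := zB j.+1.
rewrite (sqr_normB hilbert (_ - c)) (sqr_normD hilbert (_ - c)) /M; lra.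
Qed.

Lemma le_of_ler_scaled (a b c : R) :
  (forall t, 0 < t < 1 -> t * a <= t * b + t ^+ 2 * c) -> a <= b.
Proof.
move=> H; apply/ler_addgt0Pr => e e0.
(* Chosen so that [t < 1] and [t * |c| <= e]; dividing the hypothesis by [t] then gives
   [a <= b + e]. *)
pose t := e / (e + `|c| + 1).
have d0 : 0 < e + `|c| + 1 by rewrite ltr_wpDl // addr_ge0 // ltW.
have t01 : 0 < t < 1.
  rewrite divr_gt0 //= ltr_pdivrMr // mul1r -addrA ltrDl.
  by rewrite ltr_wpDl.
have /andP[t0 _] := t01.
have := H _ t01; rewrite expr2 -mulrA -mulrDr ler_pM2l // => /le_trans; apply.
rewrite lerD2l; apply: (@le_trans _ _ (t * `|c|)).
  by rewrite ler_wpM2l ?ler_norm // ltW.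
rewrite /t mulrAC ler_pdivrMr // ler_pM2l //.
by rewrite addrAC lerDr addr_ge0 // ltW.
Qed.

(** Compare [p] with the points [t *: v + (1 - t) *: p] of the segment towards [v], divide by [t]
    and let [t] tend to 0. No subdifferential is involved. *)
Lemma prox_three_point (H : completeNormedModType R) (ip : {dot H for idfun})
    (D : set H) (h : H -> R) (w p v : H) : induces_norm ip ->
  convex_on D h -> D p ->
  (forall q, D q ->
     h p + 2^-1 * `|w - p| ^+ 2 <= h q + 2^-1 * `|w - q| ^+ 2) ->
  D v ->
  h p + 2^-1 * `|w - p| ^+ 2 + 2^-1 * `|v - p| ^+ 2
    <= h v + 2^-1 * `|w - v| ^+ 2.
Proof.
move=> hilbert ch Dp pmin Dv.
apply: (@le_of_ler_scaled _ _ (2^-1 * `|v - p| ^+ 2)) => t t01.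
have [Dz hz] := ch _ _ _ Dv Dp t01.
have := pmin _ Dz.
have -> : w - (t *: v + (1 - t) *: p) = t *: (w - v) + (1 - t) *: (w - p).
  by rewrite !scalerBr addrACA -scalerDl -opprD addrCA subrr addr0 scale1r.
have e : `|w - v - (w - p)| = `|v - p|.
  by rewrite opprB addrC addrA subrK distrC.
rewrite (sqr_norm_conv hilbert) e.
move: hz; set A := h _; set a := h p; set b := h v; set x := `|v - p| ^+ 2.
by move=> h1 h2; nra.
Qed.

End Convexity.

(** * Riesz representation and the gradient inequality *)

Section Gradient.
Context {R : realType} {H : completeNormedModType R}.
Variable ip : {dot H for idfun}.
Hypothesis hilbert : induces_norm ip.

(* The representative is the minimizer of [|u|^2 / 2 - L u], the proximal point
   of [- L] at 0: minimizing sequences are Cauchy by strong convexity, and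
   the three-point inequality at [p + u] and [p - u] gives [L u = ip p u]. *)
Lemma riesz_representation (L : {linear H -> R}) : continuous L ->
  exists v, forall u, L u = ip v u.
Proof.
move=> cL.
have [C C0 LC] : exists2 C, 0 < C & forall u, `|L u| <= C * `|u|.
  have /linear_boundedP/pinfty_ex_gt0[C C0 hC] :=
    continuous_linear_bounded 0 (cL 0).
  by exists C.
have LZ a u : L (a *: u) = a * L u by exact: linearZ.
pose q u := - L u + 2^-1 * `|0 - u| ^+ 2.
have q_lb u : - (2^-1 * C ^+ 2) <= q u.
  rewrite /q sub0r normrN.
  have := LC u; rewrite ler_norml => /andP[_ h].
  have := sqr_ge0 (`|u| - C); nra.
have has_q : has_inf [set q u | u in setT].
  split; first by exists (q 0), 0.
  by exists (- (2^-1 * C ^+ 2)) => _ [u _ <-].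
set m := inf [set q u | u in setT].
have m_le u : m <= q u by apply: ge_inf; [exact: has_q.2|exists u].
have cvxL : convex_on setT (fun u => - L u).
  move=> u v t _ _ _; split => //.
  by rewrite linearD !LZ opprD !mulrN.
have ex_seq n : exists u, q u < m + n.+1%:R^-1.
  have [//|_ [u _ <-] hu] := @inf_adherent _ _ n.+1%:R^-1 _ has_q.
  by exists u.
have [z hz] := choice ex_seq.
(* The value at the midpoint is the mean of [q u] and [q v] minus [|u - v|^2 / 8], and it is at
   least [m]. *)
have mid u v : 4^-1 * `|u - v| ^+ 2 <= q u - m + (q v - m).
  have h12 : 0 < (2^-1 : R) < 1 by lra.
  have := m_le (2^-1 *: u + (1 - 2^-1) *: v).
  rewrite /q !sub0r !normrN (sqr_norm_conv hilbert) linearD !LZ.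
  set a := L u; set b := L v; set c := `|u - v| ^+ 2.
  lra.
have cz : cauchy (z @ \oo).
  apply/cauchyP => e e0.
  (* By [mid], two points whose values are within [e ^+ 2 / 8] of [m] are at distance less than
     [e]. *)
  have d0 : 0 < e ^+ 2 / 8 by rewrite divr_gt0 // exprn_gt0.
  have [N _ hN] := near_infty_natSinv_lt (PosNum d0).
  exists (z N); exists N => // n /= Nn.
  rewrite -ball_normE /ball_ /= -(ltr_pXn2r (n := 2)) ?nnegrE ?normr_ge0
    ?(ltW e0) //.
  have := mid (z N) (z n); have := hz N; have := hz n.
  have : n.+1%:R^-1 < e ^+ 2 / 8 := hN n Nn.
  have : N.+1%:R^-1 < e ^+ 2 / 8 := hN N (leqnn N).
  move: (n.+1%:R^-1) (N.+1%:R^-1) => a b; lra.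
have /cauchy_cvg zcvg := cz.
pose p := lim (z @ \oo).
have qp u : q p <= q u.
  apply: le_trans (m_le u); rewrite -[m]addr0.
  apply: (@ler_cvg_to _ \oo _ R (q \o z) (fun n => m + harmonic n)).
  - apply: cvgD; first by apply: cvgN; apply: continuous_cvg => //; exact: cL.
    apply: cvgM; first exact: cvg_cst.
    rewrite expr2; under eq_fun do rewrite expr2.
    by apply: cvgM; apply: cvg_norm; apply: cvgB => //; exact: cvg_cst.
  - by apply: cvgD; [exact: cvg_cst|exact: cvg_harmonic].
  - by near=> n; rewrite /= /harmonic /= ltW.
exists p => u.
have three v := @prox_three_point R H ip setT _ 0 p v hilbert cvxL I
                  (fun q0 _ => qp q0) I.
apply/eqP; rewrite eq_le; apply/andP; split.
  have := three (p + u).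
  rewrite [p + u]addrC addrK !sub0r !normrN (sqr_normD hilbert) linearD ipC.
  lra.
have := three (p - u).
rewrite [p - u]addrC addrK !sub0r !normrN (sqr_normD hilbert) linearD raddfN.
rewrite normrN ipC linearNr.
lra.
Unshelve. all: by end_near. Qed.

(** [gradient] is a [get]; Riesz representation supplies the existence that makes it meaningful. *)
Lemma gradientP (F : H -> R) y : differentiable F y ->
  forall u, 'd F y u = ip (gradient ip F y) u.
Proof.
move=> dF; have [v hv] := @riesz_representation ('d F y) (diff_continuous dF).
by apply: (getPex (P := [set v | forall u, 'd F y u = ip v u])); exists v.
Qed.

(** By concavity the difference quotients at [y] along [v - y], for [0 < t < 1], are at least
    [F v - F y]; pass to the limit from the right. *)
Lemma concave_le_gradient (F : H -> R) y v :
  convex_on setT (fun u => - F u) -> differentiable F y ->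
  F v <= F y + ip (gradient ip F y) (v - y).
Proof.
move=> cF dF; rewrite -(gradientP dF) -lerBlDl -(deriveE _ dF).
have dFv : derivable F y (v - y) := diff_derivable dF.
apply: (cvgr_to_ge (cvg_dnbhs_at_right dFv)).
near=> t; have t0 : 0 < t by near: t; exact: nbhs_right_gt.
have t1 : t < 1 by near: t; exact: nbhs_right_lt.
have [_] := cF v y t I I (introT andP (conj t0 t1)).
have -> : t *: v + (1 - t) *: y = t *: (v - y) + y.
  by rewrite scalerBr scalerBl scale1r addrAC addrA.
rewrite /= => h; rewrite ler_pdivlMl //; lra.
Unshelve. all: by end_near. Qed.

End Gradient.

(** * The algorithm on real-valued data: one step, summation, ergodic bounds *)

Section RealMinimax.
Context {R : realType} {H1 H2 : completeNormedModType R}.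
Variables (ip1 : {dot H1 for idfun}) (ip2 : {dot H2 for idfun}).
Hypotheses (hilbert1 : induces_norm ip1) (hilbert2 : induces_norm ip2).
Variables (P : set H1) (D : set H2).
Variables (phi : H1 -> H2 -> R) (gr : H2 -> R) (G : H1 -> H2 -> H2).
Variables (Lyx Lyy calpha tau sigma : R).
Variables (x : nat -> H1) (y : nat -> H2).
Hypothesis phi_convex : forall v, D v -> convex_on P (phi ^~ v).
Hypothesis phi_concave : forall u, P u -> convex_on setT (fun v => - phi u v).
Hypothesis gr_convex : convex_on D gr.
Hypothesis phi_le_grad : forall u v w, P u ->
  phi u w <= phi u v + ip2 (G u v) (w - v).
Hypothesis G_lipschitz : forall u u' v v', P u -> P u' -> D v -> D v' ->
  `|G u v - G u' v'| <= Lyx * `|u - u'| + Lyy * `|v - v'|.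
Hypotheses (Lyx_ge0 : 0 <= Lyx) (Lyy_ge0 : 0 <= Lyy) (calpha_gt : Lyx < calpha).
Hypotheses (tau_gt0 : 0 < tau) (sigma_gt0 : 0 < sigma).
Hypothesis step_sizes : (calpha * Lyx * tau + 2 * Lyy) * sigma < 1.
Hypotheses (Px : forall k, P (x k)) (Dy : forall k, D (y k)).
Hypothesis y_prox : forall k v, D v ->
  let w := y k + sigma *: (G (x k) (y k) *+ 2 - G (x k.-1) (y k.-1)) in
  sigma * gr (y k.+1) + 2^-1 * `|w - y k.+1| ^+ 2
    <= sigma * gr v + 2^-1 * `|w - v| ^+ 2.
Hypothesis x_prox : forall k u, P u ->
  tau * (phi (x k.+1) (y k.+1) - gr (y k.+1)) + 2^-1 * `|x k - x k.+1| ^+ 2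
    <= tau * (phi u (y k.+1) - gr (y k.+1)) + 2^-1 * `|x k - u| ^+ 2.

Let q k := G (x k) (y k) - G (x k.-1) (y k.-1).

(** Re-expanding the squares centred at [w] about [y k] cancels [|sigma *: s|^2]; division by
    [sigma] then leaves the inner product. *)
Lemma y_three_point k v : D v ->
  gr (y k.+1) - gr v <= ip2 (G (x k) (y k) + q k) (y k.+1 - v)
    + (2 * sigma)^-1
      * (`|v - y k| ^+ 2 - `|v - y k.+1| ^+ 2 - `|y k.+1 - y k| ^+ 2).
Proof.
move=> Dv; have cs : convex_on D (fun v => sigma * gr v).
  move=> a b t Da Db t01; have [Dt ht] := gr_convex Da Db t01; split => //.
  by rewrite mulrCA [_ * (_ * gr b)]mulrCA -mulrDr ler_pM2l.
have := prox_three_point hilbert2 cs (Dy k.+1) (@y_prox k) Dv.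
set s := _ *+ 2 - _; have -> : G (x k) (y k) + q k = s.
  by rewrite /s /q mulr2n addrA.
have e w : y k + sigma *: s - w = sigma *: s - (w - y k).
  by rewrite opprB [y k + _]addrC addrA.
rewrite !e !(sqr_normB hilbert2 (sigma *: s)).
have -> : y k.+1 - v = (y k.+1 - y k) - (v - y k).
  by rewrite opprB addrA subrK.
rewrite [ip2 _ (_ - (_ - _))]linearBr /= !(ipC ip2 (sigma *: s)).
rewrite !(ipZr ip2) !(ipC ip2 s).
move: (ip2 _ _) (ip2 _ _) => a b.
move: (`|sigma *: s| ^+ 2) => N0.
move: (`|v - y k.+1| ^+ 2) (`|y k.+1 - y k| ^+ 2) (`|v - y k| ^+ 2) => B C A h.
rewrite -lerBlDl invfM [2^-1 * _]mulrC -mulrA ler_pdivlMl //; lra.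
Qed.

Lemma x_three_point k u : P u ->
  phi (x k.+1) (y k.+1) - phi u (y k.+1) <= (2 * tau)^-1
    * (`|u - x k| ^+ 2 - `|u - x k.+1| ^+ 2 - `|x k.+1 - x k| ^+ 2).
Proof.
move=> Pu.
pose h u := tau * (phi u (y k.+1) - gr (y k.+1)).
have cs : convex_on P h.
  move=> a b t Da Db t01; have [Dt ht] := phi_convex (Dy k.+1) Da Db t01.
  split => //; rewrite /h mulrCA [(1 - t) * (tau * _)]mulrCA -mulrDr ler_pM2l //.
  by move: ht; lra.
have := prox_three_point hilbert1 cs (Px k.+1) (@x_prox k) Pu.
rewrite {cs}/h (distrC (x k) u) (distrC (x k)) invfM.
move: (`|u - x k.+1| ^+ 2) (`|x k.+1 - x k| ^+ 2) (`|u - x k| ^+ 2) => B C A.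
by move=> hle; rewrite [2^-1 * _]mulrC -mulrA ler_pdivlMl //; lra.
Qed.

(* Young's inequality with weight [calpha * tau] on the cross term in [Lyx]
   and weight [1] on the one in [Lyy] *)
Lemma ip_q_le k d : ip2 (q k) d <=
  Lyx / (2 * calpha * tau) * `|x k - x k.-1| ^+ 2
  + Lyy / 2 * `|y k - y k.-1| ^+ 2
  + (calpha * Lyx * tau + Lyy) / 2 * `|d| ^+ 2.
Proof.
apply: le_trans (ip_le_norm hilbert2 _ _) _.
have := G_lipschitz (Px k) (Px k.-1) (Dy k) (Dy k.-1).
rewrite -/(q k) => /(ler_wpM2r (normr_ge0 d)) /le_trans; apply.
set a := `|x k - _|; set b := `|y k - _|; set c := `|d|.
have ca0 : 0 < calpha by exact: le_lt_trans calpha_gt.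
set m := calpha * tau; have m0 : 0 < m by rewrite mulr_gt0.
have -> : Lyx / (2 * calpha * tau) = Lyx / 2 * m^-1.
  by rewrite -mulrA invfM mulrA.
have -> : calpha * Lyx * tau = Lyx * m by rewrite /m; ring.
have h1 : 2 * a * c <= m^-1 * a ^+ 2 + m * c ^+ 2.
  have h := sqr_ge0 (a - m * c).
  rewrite -(ler_pM2l m0) mulrDr [m * (m^-1 * _)]mulrA divff ?gt_eqF // mul1r; nra.
have h2 : 2 * b * c <= b ^+ 2 + c ^+ 2 by have := sqr_ge0 (b - c); nra.
have := ler_wpM2l Lyx_ge0 h1; have := ler_wpM2l Lyy_ge0 h2.
move: (m^-1) => i; lra.
Qed.

Lemma gap_step k u v : P u -> D v ->
  phi (x k.+1) v - gr v - (phi u (y k.+1) - gr (y k.+1)) <=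
    ip2 (q k.+1) (v - y k.+1) - ip2 (q k) (v - y k) + ip2 (q k) (y k.+1 - y k)
    + (2 * sigma)^-1
      * (`|v - y k| ^+ 2 - `|v - y k.+1| ^+ 2 - `|y k.+1 - y k| ^+ 2)
    + (2 * tau)^-1
      * (`|u - x k| ^+ 2 - `|u - x k.+1| ^+ 2 - `|x k.+1 - x k| ^+ 2).
Proof.
move=> Pu Dv.
have := y_three_point k Dv; have := x_three_point k Pu.
have := phi_le_grad (y k.+1) v (Px k.+1).
(* [e1] pairs the gradients at consecutive iterates; [e2] goes through [y k] to expose a telescoping
   difference. *)
have e1 : ip2 (q k.+1) (v - y k.+1)
    = ip2 (G (x k.+1) (y k.+1)) (v - y k.+1) + ip2 (G (x k) (y k)) (y k.+1 - v).
  by rewrite /q linearBl /= -[y k.+1 - v]opprB linearNr.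
have e2 : - ip2 (q k) (v - y k) + ip2 (q k) (y k.+1 - y k)
    = ip2 (q k) (y k.+1 - v).
  by rewrite addrC -linearBr /= opprB addrA subrK.
rewrite [ip2 (_ + _) _]linearDl /=; move: (_^-1 * _) (_^-1 * _) => A B; lra.
Qed.

(** The reduced coefficient of [|v - y k|^2] is the price of bounding the surviving product
    [ip2 (q k) (v - y k)] by [ip_q_le]. *)
Lemma gap_sum k u v : P u -> D v ->
  \sum_(j < k) (phi (x j.+1) v - gr v - (phi u (y j.+1) - gr (y j.+1)))
    + (2 * tau)^-1 * `|u - x k| ^+ 2
    + ((2 * sigma)^-1 - (calpha * Lyx * tau + Lyy) / 2) * `|v - y k| ^+ 2
  <= (2 * tau)^-1 * `|u - x 0%N| ^+ 2 + (2 * sigma)^-1 * `|v - y 0%N| ^+ 2.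
Proof.
move=> Pu Dv.
have ca0 : 0 < calpha by exact: le_lt_trans calpha_gt.
set a := Lyx / (2 * calpha * tau); set b := Lyy / 2.
set c := (calpha * Lyx * tau + Lyy) / 2.
(* [a_le] is [Lyx < calpha], and [bc_le] is the step-size condition. *)
have a_le : a <= (2 * tau)^-1.
  rewrite /a [2 * _]mulrC -mulrA ler_pdivrMr ?mulr_gt0 // mulrCA.
  by rewrite mulVf ?mulr1 ?ltW // gt_eqF ?mulr_gt0.
have bc_le : c + b <= (2 * sigma)^-1.
  rewrite -[leRHS]div1r ler_pdivlMr ?mulr_gt0 // /b /c; have := step_sizes; lra.
(* Strengthened induction: the terms in [a] and [b] are held in reserve to pay for [ip_q_le] at the
   next step, which [a_le] and [bc_le] replenish. *)
suff : \sum_(j < k) (phi (x j.+1) v - gr v - (phi u (y j.+1) - gr (y j.+1)))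
    + (2 * tau)^-1 * `|u - x k| ^+ 2 + (2 * sigma)^-1 * `|v - y k| ^+ 2
    + a * `|x k - x k.-1| ^+ 2 + b * `|y k - y k.-1| ^+ 2
    <= (2 * tau)^-1 * `|u - x 0%N| ^+ 2 + (2 * sigma)^-1 * `|v - y 0%N| ^+ 2
       + ip2 (q k) (v - y k).
  by have := ip_q_le k (v - y k); rewrite -/a -/b -/c; lra.
elim: k => [|k IH].
  (* Since [0.-1 = 0], [q 0] and the reserve terms vanish. *)
  by rewrite big_ord0 add0r /q /= !subrr linear0l !normr0 expr0n /= !mulr0 !addr0.
rewrite big_ord_recr /=.
have := gap_step k Pu Dv; have := ip_q_le k (y k.+1 - y k).
rewrite -/a -/b -/c.
have := ler_wpM2r (sqr_ge0 `|x k.+1 - x k|) a_le.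
have := ler_wpM2r (sqr_ge0 `|y k.+1 - y k|) bc_le.
move: IH; lra.
Qed.

Local Notation xbar := (ergodic_average (fun=> 1) x).
Local Notation ybar := (ergodic_average (fun=> 1) y).

(** Convexity of [P] is read off from [phi ^~ y 0]. *)
Lemma ergodic_x_dom k : (0 < k)%N -> P (xbar k).
Proof. by case/(jensen_ergodic (phi_convex (Dy 0)) Px). Qed.

Lemma ergodic_y_dom k : (0 < k)%N -> D (ybar k).
Proof. by case/(jensen_ergodic gr_convex Dy). Qed.

(** Jensen is applied to [phi ^~ v], [gr] and [- phi u]. As [u] and [v] are arbitrary, they may be
    averages depending on [k]. *)
Lemma ergodic_gap k u v : (0 < k)%N -> P u -> D v ->
  phi (xbar k) v - gr v - (phi u (ybar k) - gr (ybar k)) <=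
  k%:R^-1 * ((2 * tau)^-1 * `|u - x 0%N| ^+ 2
             + (2 * sigma)^-1 * `|v - y 0%N| ^+ 2).
Proof.
move=> k0 Pu Dv; rewrite ler_pdivlMl ?ltr0n //.
apply: le_trans (gap_sum k Pu Dv).
have [_ h1] := jensen_ergodic (phi_convex Dv) Px k0.
have [_ h2] := jensen_ergodic gr_convex Dy k0.
have [_ h3] := @jensen_ergodic _ _ _ _ y k (phi_concave Pu) (fun=> I) k0.
have c0 : 0 <= (2 * sigma)^-1 - (calpha * Lyx * tau + Lyy) / 2.
  rewrite subr_ge0 -[leRHS]div1r ler_pdivlMr ?mulr_gt0 //.
  have := mulr_ge0 Lyy_ge0 (ltW sigma_gt0); have := step_sizes; lra.
have t0 : 0 <= (2 * tau)^-1 by rewrite invr_ge0 mulr_ge0 ?ltW.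
apply: le_trans (_ : _ <= \sum_(j < k)
    (phi (x j.+1) v - gr v - (phi u (y j.+1) - gr (y j.+1)))) _; last first.
  by rewrite -addrA lerDl addr_ge0 // mulr_ge0 // sqr_ge0.
rewrite sumrB !sumrB sumr_const card_ord -mulr_natl.
move: h3; rewrite sumrN; lra.
Qed.

Section Saddle.
Variables (us : H1) (vs : H2).
Hypotheses (Pus : P us) (Dvs : D vs).
Hypothesis saddle : forall u v, P u -> D v ->
  phi us v - gr v <= phi us vs - gr vs <= phi u vs - gr vs.

Lemma iterates_bounded : exists B, forall k,
  `|x k - us| ^+ 2 <= B /\ `|y k - vs| ^+ 2 <= B.
Proof.
set a := (2 * tau)^-1.
set c := (2 * sigma)^-1 - (calpha * Lyx * tau + Lyy) / 2.
set A := a * `|us - x 0%N| ^+ 2 + (2 * sigma)^-1 * `|vs - y 0%N| ^+ 2.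
have a0 : 0 < a by rewrite invr_gt0 mulr_gt0.
have c0 : 0 < c.
  rewrite subr_gt0 -[ltRHS]div1r ltr_pdivlMr ?mulr_gt0 //.
  have := mulr_ge0 Lyy_ge0 (ltW sigma_gt0); have := step_sizes; lra.
exists (Num.max (a^-1 * A) (c^-1 * A)) => k.
have := gap_sum k Pus Dvs; rewrite -/a -/c -/A (distrC us) (distrC vs).
(* Each summand is nonnegative: the saddle value separates its two objective values. *)
have : 0 <= \sum_(j < k)
    (phi (x j.+1) vs - gr vs - (phi us (y j.+1) - gr (y j.+1))).
  apply: sumr_ge0 => j _.
  by have /andP[] := saddle (Px j.+1) (Dy j.+1); lra.
have := mulr_ge0 (ltW a0) (sqr_ge0 `|x k - us|).
have := mulr_ge0 (ltW c0) (sqr_ge0 `|y k - vs|).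
rewrite !le_max !(ler_pdivlMl _ _ a0) !(ler_pdivlMl _ _ c0).
move=> Y0 X0 S0 le_A; split; apply/orP; [left|right]; apply: le_trans le_A.
  by rewrite addrAC lerDr addr_ge0.
by rewrite lerDr addr_ge0.
Qed.

(** The gap bounds contain distances from the averages to the starting point; boundedness of the
    iterates turns these into constants. *)
Lemma ergodic_rate : exists C, forall k, (0 < k)%N ->
  `|phi (xbar k) (ybar k) - gr (ybar k) - (phi us vs - gr vs)| <= C * k%:R^-1.
Proof.
have [B hB] := iterates_bounded.
pose bx := 2 * B + 2 * `|us - x 0%N| ^+ 2.
pose by_ := 2 * B + 2 * `|vs - y 0%N| ^+ 2.
pose a := (2 * tau)^-1; pose b := (2 * sigma)^-1.
exists (a * bx + b * by_ + a * `|us - x 0%N| ^+ 2 + b * `|vs - y 0%N| ^+ 2).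
move=> k k0.
have hx := sqr_ergodic_bounded (x 0%N) hilbert1 (fun j => (hB j).1) k0.
have hy := sqr_ergodic_bounded (y 0%N) hilbert2 (fun j => (hB j).2) k0.
have Pxk := ergodic_x_dom k0; have Dyk := ergodic_y_dom k0.
have /andP[s1 s2] := saddle Pxk Dyk.
have a0 : 0 <= a by rewrite invr_ge0 mulr_ge0 ?ltW.
have b0 : 0 <= b by rewrite invr_ge0 mulr_ge0 ?ltW.
have ki : 0 <= k%:R^-1 :> R by rewrite invr_ge0.
(* The pair [(xbar k, vs)] gives the lower bound and [(us, ybar k)] the upper one; the saddle
   inequalities bring in the saddle value. *)
have := ergodic_gap k0 Pxk Dvs; have := ergodic_gap k0 Pus Dyk.
rewrite -/a -/b.
have := ler_wpM2l ki (ler_wpM2l a0 hx); have := ler_wpM2l ki (ler_wpM2l b0 hy).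
rewrite -/bx -/by_.
have := mulr_ge0 ki (mulr_ge0 a0 (sqr_ge0 `|xbar k - x 0%N|)).
have := mulr_ge0 ki (mulr_ge0 b0 (sqr_ge0 `|ybar k - y 0%N|)).
have := mulr_ge0 ki (mulr_ge0 a0 (sqr_ge0 `|us - x 0%N|)).
have := mulr_ge0 ki (mulr_ge0 b0 (sqr_ge0 `|vs - y 0%N|)).
move: s1 s2; rewrite ler_norml; move: (k%:R^-1) => i *.
by apply/andP; split; lra.
Qed.

End Saddle.

End RealMinimax.

(** * Reduction of extended-real functions to real-valued ones *)

Section ExtendedRealReduction.
Context {R : realType}.

Lemma econvex_fine (V : completeNormedModType R) (h : V -> \bar R) :
  (forall u, -oo < h u)%E -> econvex h ->
  convex_on (edom h) (fun u => fine (h u)).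
Proof.
move=> hNy ch u v t Du Dv t01; have := ch u v t t01.
have hE w : edom h w -> (h w = (fine (h w))%:E).
  by move=> Dw; rewrite fineK // fin_real // hNy.
rewrite (hE _ Du) (hE _ Dv) -!EFinM -EFinD => le_h.
have Dw : edom h (t *: u + (1 - t) *: v) := le_lt_trans le_h (ltry _).
by split => //; move: le_h; rewrite (hE _ Dw) lee_fin.
Qed.

Context {H1 H2 : completeNormedModType R} {ip2 : {dot H2 for idfun}}.
Context {Phi : H1 -> H2 -> \bar R} {g : H2 -> \bar R} {nu Lyx Lyy : R}.
Hypothesis standing : standing_assumptions ip2 Phi g nu Lyx Lyy.

Lemma Phi_fineK u v : proj_dom Phi u -> Phi u v = (fine (Phi u v))%:E.
Proof.
move=> Pu; rewrite fineK // fin_real // (Phi_gtNy standing) /=.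
by have : edom (Phi u) v by rewrite (Phi_dom standing Pu).
Qed.

Lemma g_fineK v : edom g v -> g v = (fine (g v))%:E.
Proof. by move=> Dv; rewrite fineK // fin_real // (g_proper standing).1. Qed.

Lemma objective_fineE u v : proj_dom Phi u -> edom g v ->
  objective Phi g u v = (fine (Phi u v) - fine (g v))%:E.
Proof. by move=> Pu Dv; rewrite /objective Phi_fineK // g_fineK. Qed.

(** [Phi u] is finite everywhere once it is below [+oo] somewhere, so one set [P] serves every
    [v]. *)
Lemma edom_Phi v : edom g v -> edom (Phi ^~ v) = proj_dom Phi.
Proof.
move=> Dv; apply/seteqP; split => u /= Pu; first by exists v.
by rewrite /edom /= Phi_fineK // ltry.
Qed.

Lemma objective_lty_dom u v : edom g v -> (objective Phi g u v < +oo)%E ->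
  proj_dom Phi u.
Proof.
move=> Dv h; exists v; move: h; rewrite /objective (g_fineK Dv).
by have := Phi_gtNy standing u v; case: (Phi u v) => // r; rewrite ltry.
Qed.

Lemma saddle_point_dom us vs : saddle_point Phi g us vs ->
  proj_dom Phi us /\ edom g vs.
Proof.
move=> saddle; have [gNy [v0 Dv0]] := g_proper standing.
have [u0 [v1 Pu0]] := dom_Phi_neq0 standing.
have {}Pu0 : proj_dom Phi u0 by exists v1.
have Dvs : edom g vs.
  (* Otherwise [objective u0 ys = -oo], yet it dominates [objective xs v0], which exceeds [-oo]. *)
  rewrite /edom /= ltey; apply/eqP => gy.
  have /andP[h1 h2] := saddle u0 v0; have := le_trans h1 h2.
  rewrite /objective gy (Phi_fineK vs Pu0) (g_fineK Dv0).
  by have := Phi_gtNy standing us v0; case: (Phi us v0).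
split => //; apply: (objective_lty_dom Dvs).
have /andP[_ h] := saddle u0 v0; apply: le_lt_trans h _.
by rewrite objective_fineE // ltry.
Qed.

End ExtendedRealReduction.

(** * Bounds, convergence and rate for the extended-real objective *)

Theorem theorem3p4 (R : realType) (H1 H2 : completeNormedModType R)
    (ip1 : {dot H1 for idfun}) (ip2 : {dot H2 for idfun})
    (hilbert1 : induces_norm ip1) (hilbert2 : induces_norm ip2)
    (Phi : H1 -> H2 -> \bar R) (g : H2 -> \bar R) (Lyx Lyy : R)
    (standing : standing_assumptions ip2 Phi g 0 Lyx Lyy)
    (xs : H1) (ys : H2) (saddle : saddle_point Phi g xs ys)
    (calpha tau sigma : R) (calpha_gt : Lyx < calpha)
    (tau_pos : 0 < tau) (sigma_pos : 0 < sigma)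
    (step_sizes : (calpha * Lyx * tau + 2 * Lyy) * sigma < 1)
    (x : nat -> H1) (y : nat -> H2)
    (algo : OGAProx ip2 Phi g
              (fun=> sigma) (fun=> tau) (fun=> 1) x y) :
  let f := objective Phi g in
  let xhat := ergodic_average (fun=> 1) x in
  let yhat := ergodic_average (fun=> 1) y in
  [/\ forall k : nat, (0 < k)%N ->
        ((- (k%:R^-1 * ((2 * tau)^-1 * `|xhat k - x 0%N| ^+ 2
                        + (2 * sigma)^-1 * `|ys - y 0%N| ^+ 2)))%:E
           <= f (xhat k) (yhat k) - f xs ys)%E
        /\ (f (xhat k) (yhat k) - f xs ys
           <= (k%:R^-1 * ((2 * tau)^-1 * `|xs - x 0%N| ^+ 2
                          + (2 * sigma)^-1 * `|yhat k - y 0%N| ^+ 2))%:E)%E,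
      f (xhat k) (yhat k) @[k --> \oo] --> f xs ys
    & (fun k : nat => fine `|f (xhat k) (yhat k) - f xs ys|%E)
        =O_\oo (fun k : nat => k%:R^-1 : R)].
Proof.
move=> f xhat yhat.
pose P := proj_dom Phi; pose D := edom g.
pose phi u v := fine (Phi u v); pose gr v := fine (g v).
have [Pxs Dys] := saddle_point_dom standing saddle.
have gNy := (g_proper standing).1.
have Dy k : D (y k).
  case: k => [|k]; first exact: y0_dom algo.
  (* Minimality against [y 0], where the proximal objective is finite, forces [g (y k.+1)] below
     [+oo]; likewise for [x] below. *)
  have := y_step algo k (y 0%N); rewrite (g_fineK standing (y0_dom algo)).
  rewrite -EFinM -EFinD => /le_lt_trans /(_ (ltry _)).
  rewrite /D /edom /=; have := gNy (y k.+1); case: (g (y k.+1)) => // r.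
  by rewrite gt0_muley ?lte_fin.
have Px k : P (x k).
  case: k => [|k]; first exact: x0_dom algo.
  apply: (objective_lty_dom standing (Dy k.+1)).
  have := x_step algo k (x 0%N).
  rewrite (objective_fineE standing (x0_dom algo) (Dy k.+1)).
  rewrite -EFinM -EFinD => /le_lt_trans /(_ (ltry _)).
  case: (objective _ _ _ _) => [r _|h|_]; rewrite ?ltry ?ltNyr //.
  by move: h; rewrite gt0_muley ?lte_fin.
have phi_convex v : D v -> convex_on P (phi ^~ v).
  move=> Dv; rewrite /P -(edom_Phi standing Dv).
  apply: (@econvex_fine _ _ (Phi ^~ v)); last exact: (Phi_convex standing).
  by move=> u; exact: (Phi_gtNy standing).
have phi_concave u : P u -> convex_on setT (fun v => - phi u v).
  move=> Pu; have -> : setT = edom (fun v => - Phi u v)%E.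
    apply/seteqP; split => v //= _.
    by rewrite /edom /= (Phi_fineK standing) // -EFinN ltry.
  have -> : (fun v => - phi u v) = (fun v => fine (- Phi u v)%E).
    by apply/funext => v; rewrite fineN.
  apply: econvex_fine; last exact: (Phi_concave standing).
  by move=> v; rewrite (Phi_fineK standing) // -EFinN ltNyr.
have gr_convex : convex_on D gr.
  apply: econvex_fine => // u v t t01.
  by have := (g_convex standing) u v t t01; rewrite !mul0r !sube0.
have le_grad u v w : P u ->
    phi u w <= phi u v + ip2 (grad_y ip2 Phi u v) (w - v).
  move=> Pu; apply: concave_le_gradient => //; first exact: phi_concave.
  exact: (Phi_differentiable standing).
have y_prox k v : D v ->
    let w := y k + sigma *: (grad_y ip2 Phi (x k) (y k) *+ 2
                             - grad_y ip2 Phi (x k.-1) (y k.-1)) in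
    sigma * gr (y k.+1) + 2^-1 * `|w - y k.+1| ^+ 2
      <= sigma * gr v + 2^-1 * `|w - v| ^+ 2.
  move=> Dv /=; have := y_step algo k v.
  rewrite (g_fineK standing Dv) (g_fineK standing (Dy k.+1)).
  by rewrite -!EFinM -!EFinD lee_fin scalerDl !scale1r -mulr2n.
have x_prox k u : P u ->
    tau * (phi (x k.+1) (y k.+1) - gr (y k.+1)) + 2^-1 * `|x k - x k.+1| ^+ 2
      <= tau * (phi u (y k.+1) - gr (y k.+1)) + 2^-1 * `|x k - u| ^+ 2.
  move=> Pu; have := x_step algo k u.
  rewrite (objective_fineE standing Pu (Dy k.+1)).
  rewrite (objective_fineE standing (Px k.+1) (Dy k.+1)).
  by rewrite -!EFinM -!EFinD lee_fin.
have G_lip := grad_y_lipschitz standing.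
have saddleR u v : P u -> D v ->
    phi xs v - gr v <= phi xs ys - gr ys <= phi u ys - gr ys.
  by move=> Pu Dv; have := saddle u v; rewrite !(objective_fineE standing).
have Pxhat k : (0 < k)%N -> P (xhat k)
  by exact: (ergodic_x_dom phi_convex Px Dy).
have Dyhat k : (0 < k)%N -> D (yhat k)
  by exact: (ergodic_y_dom gr_convex Dy).
have fE k : (0 < k)%N ->
    f (xhat k) (yhat k) = (phi (xhat k) (yhat k) - gr (yhat k))%:E.
  by move=> k0; exact: (objective_fineE standing (Pxhat k k0) (Dyhat k k0)).
have fsE : f xs ys = (phi xs ys - gr ys)%:E := objective_fineE standing Pxs Dys.
have gap := ergodic_gap hilbert1 hilbert2 phi_convex phi_concave gr_convex
  le_grad G_lip (Lyx_ge0 standing) (Lyy_ge0 standing) calpha_gt tau_pos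
  sigma_pos step_sizes Px Dy y_prox x_prox.
have [C rate] := ergodic_rate hilbert1 hilbert2 phi_convex phi_concave gr_convex
  le_grad G_lip (Lyx_ge0 standing) (Lyy_ge0 standing) calpha_gt tau_pos
  sigma_pos step_sizes Px Dy y_prox x_prox Pxs Dys saddleR.
split.
- move=> k k0; rewrite (fE k k0) fsE -EFinB !lee_fin.
  have /andP[s1 s2] := saddleR _ _ (Pxhat k k0) (Dyhat k k0).
  have := gap _ _ _ k0 (Pxhat k k0) Dys; have := gap _ _ _ k0 Pxs (Dyhat k k0).
  rewrite -/xhat -/yhat; move: (k%:R^-1 * _) (k%:R^-1 * _) => a b.
  by split; lra.
- rewrite fsE; apply: cvg_EFin.
    (* At [k = 0] the averages are the zero vector, which may lie outside [P] or [D]; finiteness is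
       eventual. *)
    by exists 1%N => // k /= k0; rewrite fE.
  have inv0 : (k%:R^-1 : R) @[k --> \oo] --> 0.
    by rewrite -cvg_shiftS; exact: cvg_harmonic.
  have Cinv0 : C * k%:R^-1 @[k --> \oo] --> 0.
    by rewrite -(mulr0 C); apply: cvgM => //; exact: cvg_cst.
  apply/subr_cvg0/norm_cvg0P; apply: squeeze_cvgr (cvg_cst 0) Cinv0.
  exists 1%N => // k /= k0; rewrite normr_ge0 /= fE //=.
  exact: rate.
(* The constant must be positive, while [C] comes with no sign. *)
- apply/eqO_exP; exists (`|C| + 1); first by rewrite ltr_wpDl.
  exists 1%N => // k /= k0; rewrite fE // fsE -EFinB /= normr_id.
  apply: le_trans (rate k k0) _.
  rewrite [`|k%:R^-1|]ger0_norm ?invr_ge0 // ler_wpM2r ?invr_ge0 //.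
  by rewrite (le_trans (ler_norm C)) // lerDl.
Qed.
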